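(* Let $d\ge 2$ be an integer and $n=2d$. Then $$\mathring\mu_n(d\mid d-1)_1\le\frac{2d^2}{d+1}.$$
   Context: $\mathbb{R}^n$ and $\Lambda^2(\mathbb{R}^n)$ carry their canonical Euclidean norms. **Rational subspaces.** A linear subspace $B$ of $\mathbb{R}^n$ is rational if it has a basis of vectors with rational coordinates; $\mathfrak{R}_n(e)$ is the set of rational subspaces of $\mathbb{R}^n$ of dimension $e$. **Height.** For $B\in\mathfrak{R}_n(e)$, the Plücker coordinates of $B$ are the $\binom{n}{e}$ minors of size $e\times e$ of an $n\times e$ matrix whose columns form a basis of $B$ (well defined up to a nonzero scalar); choosing a representative $\Xi$ with integer coordinates with gcd $1$, set $H(B)=\|\Xi\|$ (Euclidean norm). **Angles.** For nonzero $X,Y\in\mathbb{R}^n$ let $\psi(X,Y)=\|X\wedge Y\|/(\|X\|\,\|Y\|)$ (sine of the angle). For subspaces $A,B$ of dimensions $d,e\ge 1$ and $t=\min(d,e)$, define $\psi_1(A,B),\dots,\psi_t(A,B)$ recursively: $\psi_1(A,B)=\min\psi(X,Y)$ over $X\in A\setminus\{0\}$, $Y\in B\setminus\{0\}$, attained at unit vectors $X_1,Y_1$; given $(X_1,Y_1),\dots,(X_j,Y_j)$, $\psi_{j+1}(A,B)=\min\psi(X,Y)$ over nonzero $X\in A$ orthogonal to $X_1,\dots,X_j$ and nonzero $Y\in B$ orthogonal to $Y_1,\dots,Y_j$, attained at unit vectors $X_{j+1},Y_{j+1}$. (These numbers do not depend on the choices.) **Irrationality and exponents.** Let $d,e\in\{1,\dots,n-1\}$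 with $d+e\le n$ and $1\le j\le\min(d,e)$. $\mathfrak{I}_n(d,e)_j$ is the set of $d$-dimensional subspaces $A$ of $\mathbb{R}^n$ with $\dim(A\cap B)<j$ for all $B\in\mathfrak{R}_n(e)$. For $A\in\mathfrak{I}_n(d,e)_j$, $\mu_n(A\mid e)_j\in(0,+\infty]$ is the supremum of the $\beta>0$ such that $\psi_j(A,B)\le H(B)^{-\beta}$ for infinitely many $B\in\mathfrak{R}_n(e)$. Finally $\mathring\mu_n(d\mid e)_j=\inf_{A\in\mathfrak{I}_n(d,e)_j}\mu_n(A\mid e)_j$. *)

(* Defs.v *)
From HB Require Import structures.
From mathcomp Require Import all_boot all_order all_algebra.
From mathcomp Require Import all_classical all_reals all_analysis.

Set Implicit Arguments.
Unset Strict Implicit.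
Unset Printing Implicit Defensive.

Import Order.TTheory GRing.Theory Num.Theory.

Local Open Scope classical_set_scope.
Local Open Scope ring_scope.

Section Defs.
Variable R : realType.

Section Ambient.
Variable n : nat.
(* R^n is the space of row vectors. The library norm on matrices is the sup
   norm, so the Euclidean one is defined here. *)
Local Notation V := 'rV[R]_n.
Implicit Types (X Y : V) (A B : {vspace V}).

Definition dotv X Y : R := \sum_i X 0 i * Y 0 i.

Definition enorm X : R := Num.sqrt (dotv X X).

(* ||X /\ Y||, for the norm on the exterior square that makes the vectors
   e_i /\ e_j, i < j, orthonormal *)
Definition wedge_norm X Y : R :=
  Num.sqrt (\sum_(i < n) \sum_(j < n | (i < j)%N)
              (X 0 i * Y 0 j - X 0 j * Y 0 i) ^+ 2).

Definition psi X Y : R := wedge_norm X Y / (enorm X * enorm Y).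

(* The pairs over which the next angle is minimized, once the pairs in s have
   been selected *)
Definition admissible A B (s : seq (V * V)) : set (V * V) :=
  [set p | [/\ p.1 \in A, p.1 != 0, p.2 \in B, p.2 != 0 &
     forall q, q \in s -> dotv p.1 q.1 = 0 /\ dotv p.2 q.2 = 0]].

Definition minimizing A B (s : seq (V * V)) : set (V * V) :=
  [set p | [/\ admissible A B s p, enorm p.1 = 1, enorm p.2 = 1 &
     forall q, admissible A B s q -> psi p.1 p.2 <= psi q.1 q.2]].

(* [:: (X_1, Y_1); ...; (X_j, Y_j)], each pair chosen among the minimizing
   ones; such pairs exist as long as j <= min (dim A) (dim B). *)
Fixpoint principal_pairs A B (j : nat) : seq (V * V) :=
  if j is k.+1 then
    let s := principal_pairs A B k in rcons s (xget (0, 0) (minimizing A B s))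
  else [::].

(* psi_j(A, B), with 1-based index j *)
Definition psi_angle (j : nat) A B : R :=
  let p := last (0, 0) (principal_pairs A B j) in psi p.1 p.2.

Definition rational_subspace B : Prop :=
  exists s : seq 'rV[rat]_n, basis_of B [seq map_mx (ratr : rat -> R) v | v <- s].

Definition rational_subspaces (e : nat) : set {vspace V} :=
  [set B | rational_subspace B /\ \dim B = e].

(* The minors of size e are indexed by the increasing maps from 'I_e to 'I_n. *)
Definition increasing (e : nat) (f : {ffun 'I_e -> 'I_n}) : bool :=
  [forall i : 'I_e, forall j : 'I_e, (i < j)%N ==> (f i < f j)%N].

(* Xi is a family of Pluecker coordinates of B that are coprime integers. The
   basis of B is given by the rows of M, as vectors are rows. *)
Definition primitive_pluecker B (Xi : {ffun 'I_(\dim B) -> 'I_n} -> int) : Prop :=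
  (exists (M : 'M[R]_(\dim B, n)) (c : R),
     [/\ basis_of B [seq row i M | i <- enum 'I_(\dim B)], c != 0 &
      forall f, increasing f -> (Xi f)%:~R = c * \det (colsub f M)]) /\
  \big[gcdn/0%N]_(f | increasing f) `|Xi f|%N = 1%N.

(* Xi is unique up to sign, and exists exactly when B is rational; the value 0
   is used for the other subspaces. *)
Definition height B : R :=
  xget 0 [set h | exists Xi, primitive_pluecker (B := B) Xi /\
    h = Num.sqrt (\sum_(f | increasing f) ((Xi f)%:~R : R) ^+ 2)].

Definition irrational_subspaces (d e j : nat) : set {vspace V} :=
  [set A | \dim A = d /\
     forall B, rational_subspaces e B -> (\dim (A :&: B) < j)%N].

Definition mu (A : {vspace V}) (e j : nat) : \bar R :=
  ereal_sup [set beta%:E | beta in [set beta : R | 0 < beta /\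
    infinite_set [set B | rational_subspaces e B /\
                          psi_angle j A B <= height B `^ (- beta)]]].

End Ambient.

Definition mu_ring (n d e j : nat) : \bar R :=
  ereal_inf [set mu A e j | A in @irrational_subspaces n d e j].

End Defs.

(* Main.v *)
Require Import Defs.
From HB Require Import structures.
From mathcomp Require Import all_boot all_order all_algebra.
From mathcomp Require Import all_fingroup all_field.
From mathcomp Require Import ring lra zify.
From mathcomp Require Import all_classical all_reals all_analysis.

Set Implicit Arguments.
Unset Strict Implicit.
Unset Printing Implicit Defensive.

Import Order.TTheory GRing.Theory Num.Theory.

Local Open Scope ring_scope.

(** The infimum is bounded by the exponent of one explicit subspace. Let [m] be
the power of two with [2 d <= m <= 4 (d - 1)]. The number
[theta = 2 cos (pi / (2 m))] generates a real cyclic extension of degree [m] of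
the rationals, whose Galois group is generated by
[sigma : theta |-> theta ^ 3 - 3 theta] ([cyclic_real_field]). For a vector [X],
let [L_i(X) = \sum_l X_l sigma^i(theta) ^ l]; on rational vectors, the [L_i] are
conjugate to each other. The subspace is
[A = {X | L_0(X) = ... = L_(d-1)(X) = 0}] ([conj_kernel]), of dimension
[2 d - d = d].

Let [B] be a rational subspace of dimension [e = d - 1] and let [D_i] be the
determinant of [L_i, ..., L_(i+e-1)] on a basis of [B], normalized so that the
Pluecker coordinates of the basis are coprime integers. Then [D_0] lies in
[Z[theta]] and the [D_i] are its conjugates. It is nonzero: this is the
nonvanishing of a Casorati determinant, the analogue of the Wronskian for
[sigma] ([casorati_neq0]). Hence the product of [D_0, ..., D_(m-1)] is a nonzero
integer ([prod_det_conj_ge1]). Each [D_i] is [O(H(B))]. Moreover, if a unit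
vector [Y] of [B] makes with [A] an angle of sine [psi_1(A, B)], then
[L_0, ..., L_(d-1)] take at [Y] values that are [O(psi_1(A, B))]; since [e < d],
these are all the forms that occur in [D_0] and in [D_1], so that both are
[O(H(B) psi_1(A, B))] ([det_mulmx_small_le]). Therefore
[1 = O(H(B) ^ m psi_1(A, B) ^ 2)] ([conj_kernel_lower_bound]). As there are
finitely many subspaces of bounded height ([finite_bounded_height]), the exponent
of [A] is at most [m / 2 <= 2 (d - 1) <= 2 d ^ 2 / (d + 1)]. *)

(** * Chebyshev polynomials of degree a power of two *)

(** The Chebyshev polynomial of degree [2 ^ k], normalized so that it maps
[2 cos x] to [2 cos (2 ^ k x)]; [2 cos (pi / 2 ^ k.+1)] is one of its roots. *)
Fixpoint cheb (k : nat) : {poly int} :=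
  if k is k'.+1 then cheb k' ^+ 2 - 2%:P else 'X.

Lemma cheb_monic_size k : cheb k \is monic /\ size (cheb k) = (2 ^ k).+1.
Proof.
elim: k => [|k [mk sk]] /=; first by rewrite monicX size_polyX.
have s2 : size (cheb k ^+ 2) = (2 ^ k.+1).+1.
  have := size_exp (cheb k) 2; rewrite sk /= -expnSr => <-.
  by rewrite prednK // size_poly_gt0 expf_neq0 ?monic_neq0.
have lt2 : (size (- (2%:P : {poly int})) < size (cheb k ^+ 2)%R)%N.
  by rewrite size_polyN size_polyC s2 ltnS expn_gt0.
split; last by rewrite size_polyDl // s2.
by rewrite monicE lead_coefDl // (monicP (monic_exp 2 mk)).
Qed.

(** Modulo 2, each step of the recursion is the squaring; this is the main
hypothesis of Eisenstein's criterion at 2. *)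
Lemma cheb_mod2 k : exists q, cheb k = 'X^(2 ^ k) + 2 *: q.
Proof.
elim: k => [|k [q Eq]]; first by exists 0; rewrite scaler0 addr0.
exists (2 *: ('X^(2 ^ k) * q) + 2 *: q ^+ 2 - 1) => /=.
rewrite Eq expnSr exprM -!mul_polyC; ring.
Qed.

Lemma cheb_coef0 k : (0 < k)%N -> (cheb k)`_0 = 2 \/ (cheb k)`_0 = -2.
Proof.
have H j : (cheb j.+1)`_0 = (cheb j)`_0 ^+ 2 - 2.
  by rewrite /= coefB coefC /= expr2 coef0M expr2.
case: k => // k _; elim: k => [|k IH]; first by right; rewrite H coefX.
by left; rewrite H; case: IH => ->.
Qed.

Lemma cheb_irreducible k : (0 < k)%N ->
  monic_irreducible_poly (map_poly (intr : int -> rat) (cheb k)).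
Proof.
move=> k0; have [mk sk] := cheb_monic_size k.
split; last by exact: monic_map.
apply/irreducible_rat_int/(@eisenstein_crit 2) => //.
- by rewrite sk eqSS -lt0n expn_gt0.
- by rewrite (monicP mk).
- by case: (cheb_coef0 k0) => ->.
move=> i; rewrite sk /= => lti; have [q ->] := cheb_mod2 k.
by rewrite coefD coefXn coefZ (ltn_eqF lti) add0r dvdz_mulr.
Qed.

(** The polynomial that maps [2 cos x] to [2 cos (3 x)]. *)
Definition triple {A : nzRingType} : {poly A} := 'X^3 - 3 *: 'X.

Lemma triple_compE (A : comNzRingType) (p : {poly A}) :
  triple \Po p = p ^+ 3 - 3 *: p.
Proof. by rewrite /triple rmorphB /= linearZ /= comp_polyX comp_Xn_poly. Qed.

Lemma map_triple (A B : nzRingType) (g : {rmorphism A -> B}) :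
  map_poly g triple = triple.
Proof. by rewrite /triple rmorphB /= map_polyXn map_polyZ /= map_polyX rmorph_nat. Qed.

(** Both sides map [2 cos x] to [2 cos (3 * 2 ^ k * x)]. Hence [triple] maps
roots of [cheb k] to roots: it induces an endomorphism of the field that they
generate. *)
Lemma cheb_comp_triple k : cheb k \Po triple = triple \Po cheb k.
Proof.
elim: k => [|k IH] /=; first by rewrite comp_polyX comp_polyXr.
rewrite rmorphB rmorphXn /= IH !triple_compE comp_polyC -!mul_polyC; ring.
Qed.

(** * Morphisms from a quotient field, and cosines *)

(** The universal property of the quotient field of [{poly F}] by an irreducible
[h]: a morphism that kills [h] factors through it. *)
Section QuotientLift.
Variables (F : fieldType) (h : {poly F}) (hI : monic_irreducible_poly h).
Variables (S : comNzRingType) (phi : {rmorphism {poly F} -> S}).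

Definition qlift of phi h = 0 := fun x : {poly %/ h with hI} => phi (val x).

Hypothesis phi0 : phi h = 0.

Lemma qlift_in p : qlift phi0 (in_qpoly h p) = phi p.
Proof.
have mh : h \is monic by apply: hI.2.
rewrite /qlift /= mk_monicE // {2}(Pdiv.RingMonic.rdivp_eq mh p).
by rewrite rmorphD rmorphM phi0 mulr0 add0r.
Qed.

Lemma qpoly_valK (x : {poly %/ h with hI}) : in_qpoly h (val x) = x.
Proof. exact/val_inj/in_qpoly_small/size_mk_monic. Qed.

Fact qlift_zmod_morphism : zmod_morphism (qlift phi0).
Proof.
by move=> x y; rewrite -[x]qpoly_valK -[y]qpoly_valK -rmorphB !qlift_in rmorphB.
Qed.

Fact qlift_monoid_morphism : monoid_morphism (qlift phi0).
Proof.
split=> [|x y]; first by rewrite -(rmorph1 (in_qpoly h)) qlift_in rmorph1.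
by rewrite -[x]qpoly_valK -[y]qpoly_valK -rmorphM !qlift_in rmorphM.
Qed.

HB.instance Definition _ := GRing.isZmodMorphism.Build _ _ (qlift phi0)
  qlift_zmod_morphism.
HB.instance Definition _ := GRing.isMonoidMorphism.Build _ _ (qlift phi0)
  qlift_monoid_morphism.
End QuotientLift.

Section Cos.
Variable R : realType.
Implicit Types (x : R).

Lemma cheb_cos k x : (map_poly intr (cheb k)).[2 * cos x] = 2 * cos (2 ^+ k * x).
Proof.
elim: k => [|k IH] /=; first by rewrite map_polyX hornerX expr0 mul1r.
rewrite rmorphB rmorphXn /= map_polyC !hornerE IH.
have -> : 2 ^+ k.+1 * x = (2 ^+ k * x) *+ 2 by rewrite exprS mulr2n; ring.
by rewrite cos_mulr2n !mulr2n; ring.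
Qed.

Lemma cos_triple x : 2 * cos (3 * x) = (2 * cos x) ^+ 3 - 3 * (2 * cos x).
Proof.
have -> : 3 * x = x *+ 2 + x by rewrite mulr2n; ring.
rewrite cosD cos_mulr2n sin_mulr2n !mulr2n.
have -> : (cos x * sin x + cos x * sin x) * sin x = 2 * cos x * sin x ^+ 2.
  ring.
by rewrite sin2cos2; ring.
Qed.

Lemma cosD_natpi n x : cos (x + n%:R * pi) = (-1) ^+ n * cos x.
Proof.
elim: n => [|n IH]; first by rewrite mul0r addr0 mul1r.
by rewrite -natr1 mulrDl mul1r addrA cosDpi IH exprS mulN1r mulNr.
Qed.

(** The unit 3 generates a subgroup of order [2 ^ k] modulo [2 ^ k.+2], and
[3 ^ 2 ^ k.-1] is [1 + 2 ^ k.+1] there when [1 < k]: this gives the order of the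
automorphism [2 cos x |-> 2 cos (3 x)]. *)
Lemma pow3_pow2 k : (0 < k)%N -> exists2 q, odd q & (3 ^ 2 ^ k = 1 + 2 ^ k.+2 * q)%N.
Proof.
case: k => // k _; elim: k => [|k [q oq IH]]; first by exists 1%N.
exists (q + 2 ^ k.+2 * q ^ 2)%N; first by rewrite oddD oq oddM oddX.
rewrite expnSr expnM IH !expnS; ring.
Qed.
End Cos.

(** * The real cyclic field generated by a cosine *)

Section FieldConstruction.
Variables (R : realType) (k : nat).
Hypothesis k1 : (1 < k)%N.

Let f : {poly rat} := map_poly (intr : int -> rat) (cheb k).
Let fI : monic_irreducible_poly f := cheb_irreducible (ltnW k1).
Local Notation K := {poly %/ f with fI}.
(* 2 cos phi is a root of f *)
Let phi : R := pi / 2 ^+ k.+1.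

Let triple_comp : {rmorphism {poly rat} -> K} := in_qpoly f \o comp_poly triple.
Let eval_real : {rmorphism {poly rat} -> R} :=
  horner_eval (2 * cos phi) \o map_poly ratr.

Fact in_qpoly_self : in_qpoly f f = 0 :> K.
Proof. 
apply: val_inj => /=; rewrite mk_monicE //; exact: Pdiv.RingMonic.rmodpp fI.2.
Qed.

Fact triple_comp0 : triple_comp f = 0.
Proof.
rewrite /triple_comp /=  -(map_triple intr) -map_comp_poly cheb_comp_triple.
rewrite map_comp_poly map_triple triple_compE -/f.
have -> : f ^+ 3 - 3 *: f = f * (f ^+ 2 - 3%:P) by rewrite -mul_polyC; ring.
by rewrite in_qpolyM in_qpoly_self mul0r.
Qed.

Fact eval_real0 : eval_real f = 0.
Proof.
rewrite /eval_real /= /horner_eval -map_poly_comp /=.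
have -> : map_poly (ratr \o intr) (cheb k) = map_poly intr (cheb k) :> {poly R}.
  by apply: eq_map_poly => z /=; rewrite ratr_int.
rewrite cheb_cos /phi.
have -> : 2 ^+ k * (pi / 2 ^+ k.+1) = pi / 2 :> R.
  by rewrite exprS; field; rewrite expf_neq0.
by rewrite cos_pihalf mulr0.
Qed.

Let sigma : {rmorphism K -> K} := @qlift _ _ fI _ _ triple_comp0.
Let iota : {rmorphism K -> R} := @qlift _ _ fI _ _ eval_real0.
Let theta : K := in_qpoly f 'X.
Let j : {rmorphism rat -> K} := qfpoly_const fI.

Fact map_horner_theta p : (map_poly j p).[theta] = in_qpoly f p.
Proof. by rewrite -[in RHS](comp_polyXr p) in_qpoly_comp_horner. Qed.

Fact sigma_in p : sigma (in_qpoly f p) = in_qpoly f (p \Po triple).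
Proof. exact: (@qlift_in _ _ fI _ _ triple_comp0). Qed.

Fact iota_in p : iota (in_qpoly f p) = (map_poly ratr p).[2 * cos phi].
Proof. exact: (@qlift_in _ _ fI _ _ eval_real0). Qed.

Fact sigma_theta : sigma theta = theta ^+ 3 - 3 * theta.
Proof.
rewrite /theta sigma_in comp_polyX /triple.
have -> : 'X^3 - 3 *: 'X = 'X * 'X * 'X - ('X + 'X + 'X) :> {poly rat}.
  by rewrite -mul_polyC; ring.
rewrite in_qpolyD -scaleN1r in_qpolyZ !in_qpolyM !in_qpolyD -/theta scaleN1r; ring.
Qed.

Fact iota_iter i : iota (iter i sigma theta) = 2 * cos (3 ^+ i * phi).
Proof.
elim: i => [|i IH].
  by rewrite [iter 0 _ _]/= /theta iota_in map_polyX hornerX expr0 mul1r.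
have E l : iter l.+1 sigma theta = iter l sigma theta ^+ 3 - 3 * iter l sigma theta.
  elim: l => [|l IHl]; first exact: sigma_theta.
  by rewrite [iter l.+2 _ _]iterS {1}IHl rmorphB rmorphXn rmorphM rmorph_nat.
by rewrite E rmorphB rmorphXn rmorphM rmorph_nat IH -cos_triple mulrA -exprS.
Qed.

Fact iter_sigma_inj i : injective (iter i sigma).
Proof. by elim: i => [|i IH] x y //= E; by apply: IH; apply: (@fmorph_inj _ _ sigma). Qed.

Lemma cyclic_orbit_period : iter (2 ^ k) sigma theta = theta.
Proof.
apply: (@fmorph_inj _ _ iota); rewrite iota_iter -[theta in RHS]/(iter 0 sigma theta) iota_iter.
rewrite expr0 mul1r; congr (2 * _); rewrite -natrX; have [q _ ->] := pow3_pow2 (ltnW k1).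
have -> : (1 + 2 ^ k.+2 * q)%:R * phi = phi + (2 * q)%:R * pi.
  rewrite /phi natrD [(2 ^ _ * _)%:R]natrM natrX [(2 * q)%:R]natrM exprS.
  by field; rewrite expf_neq0.
by rewrite cosD_natpi exprM sqrrN !expr1n mul1r.
Qed.

(** The angle [phi] becomes [phi] plus an odd multiple of [pi]. *)
Lemma cyclic_orbit_half : iter (2 ^ k.-1) sigma theta = - theta.
Proof.
apply: (@fmorph_inj _ _ iota); rewrite rmorphN iota_iter.
rewrite -[theta in RHS]/(iter 0 sigma theta) iota_iter.
rewrite expr0 mul1r -mulrN; congr (2 * _); rewrite -natrX.
have [|q oq ->] := @pow3_pow2 k.-1; first by lia.
have -> : (1 + 2 ^ (k.-1).+2 * q)%:R * phi = phi + q%:R * pi.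
  rewrite prednK ?(ltnW k1) // /phi natrD [(2 ^ _ * _)%:R]natrM natrX.
  by field; rewrite expf_neq0.
by rewrite cosD_natpi -signr_odd oq expr1 mulN1r.
Qed.

Fact theta_neq0 : theta != 0.
Proof.
apply: contraTneq isT => th0.
have /= s := @in_qpoly_small _ f 'X.
have := congr1 (fun x : K => (val x)`_1) th0.
rewrite /= /theta s ?coefX ?coef0 //.
rewrite mk_monicE // size_polyX size_map_inj_poly ?rmorph0 //; last exact: intr_inj.
by rewrite (cheb_monic_size k).2 ltnS; exact: ltn_trans k1 (ltn_expl k (ltnSn 1)).
Qed.

(** The period of [theta] divides [2 ^ k]; a smaller one would divide
[2 ^ k.-1], and [theta] would equal [- theta]. *)
Lemma cyclic_orbit_inj :
  {in [pred i | (i < 2 ^ k)%N] &, injective (fun i => iter i sigma theta)}.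
Proof.
have noloop r : (0 < r < 2 ^ k)%N -> iter r sigma theta <> theta.
  move=> /andP[r0 rm] Er.
  have mult s t : iter s sigma theta = theta -> iter (t * s) sigma theta = theta.
    by move=> Es; elim: t => [|t IH] //; rewrite mulSn iterD IH.
  have Eg : iter (gcdn r (2 ^ k)) sigma theta = theta.
    case: (@egcdnP r (2 ^ k) r0) => a b Hab _.
    have := mult _ a Er; rewrite Hab addnC iterD.
    by rewrite (mult _ b cyclic_orbit_period).
  have /(dvdn_pfactor _ _ (isT : prime 2))[l lk El] := dvdn_gcdr r (2 ^ k).
  have lk1 : (l <= k.-1)%N.
    rewrite -ltnS prednK ?(ltnW k1) // ltn_neqAle lk andbT.
    apply: contraTneq rm => ekl; rewrite -leqNgt; apply: dvdn_leq => //.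
    by rewrite -ekl -El dvdn_gcdl.
  have := cyclic_orbit_half; rewrite -(subnK lk1) expnD -El (mult _ _ Eg).
  move=> /eqP; rewrite -subr_eq0 opprK -mulr2n -mulr_natl mulf_eq0.
  rewrite (negPf theta_neq0) orbF -(rmorph_nat j) fmorph_eq0.
  by [].
move=> i l; rewrite !inE; wlog il : i l / (i <= l)%N => [W|].
  by case/orP: (leq_total i l) => h im lm E; [|symmetry]; apply: W.
move=> im lm E; apply/eqP; rewrite eqn_leq il leqNgt /=; apply/negP => lti.
apply: (noloop (l - i)%N); first by lia.
by apply: (@iter_sigma_inj i); rewrite -iterD subnKC // -E.
Qed.

Fact size_quotient_modulus : size (mk_monic f) = (2 ^ k).+1.
Proof.
rewrite mk_monicE // size_map_inj_poly ?rmorph0 //; last exact: intr_inj.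
by rewrite (cheb_monic_size k).2.
Qed.

Lemma cheb_field :
  exists (K : fieldType) (j : {rmorphism rat -> K}) (sigma : {rmorphism K -> K})
      (iota : {rmorphism K -> R}) (theta : K),
  [/\ forall p : {poly rat}, (size p <= 2 ^ k)%N -> (map_poly j p).[theta] = 0 -> p = 0,
      forall x, exists2 p : {poly rat}, (size p <= 2 ^ k)%N & x = (map_poly j p).[theta],
      {in [pred i | (i < 2 ^ k)%N] &, injective (fun i => iter i sigma theta)},
      iter (2 ^ k) sigma theta = theta &
      integralOver (intr : int -> K) theta].
Proof.
exists K, j, sigma, iota, theta; split.
- move=> p sp; rewrite map_horner_theta => E.
  have <- : val (in_qpoly f p) = p.
    by apply: in_qpoly_small; rewrite size_quotient_modulus ltnS.
  by rewrite E.
- move=> x; exists (val x); last by rewrite map_horner_theta qpoly_valK.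
  by rewrite -ltnS -size_quotient_modulus size_mk_monic.
- exact: cyclic_orbit_inj.
- exact: cyclic_orbit_period.
exists (cheb k); first by have [] := cheb_monic_size k.
have := map_horner_theta f; rewrite in_qpoly_self -map_poly_comp /root => <-.
by apply/eqP; congr (_.[_]); apply: eq_map_poly => z /=; rewrite rmorph_int.
Qed.
End FieldConstruction.

(** * Integrality and Casorati determinants *)

(** If [q] is a root of a monic integer polynomial [p], then Gauss's lemma
factors [p] over the integers by a multiple [p1] of ['X - q]; as [p] is monic,
the leading coefficient of [p1] is invertible. *)
Lemma integral_rat_int (K : fieldType) (j : {rmorphism rat -> K}) (q : rat) :
  integralOver (intr : int -> K) (j q) -> q \is a Num.int.
Proof.
move=> [p mp rp].
have {rp} : root (map_poly (intr : int -> rat) p) q.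
  rewrite -(fmorph_root j) -map_poly_comp.
  by congr root: rp; apply: eq_map_poly => z /=; rewrite rmorph_int.
rewrite -dvdp_XsubCl => /dvdpP_rat_int[p1 [a a0 Ep1] [r Er]].
have L : (lead_coef p1)%:~R * (lead_coef r)%:~R = 1 :> rat.
  by rewrite -intrM -lead_coefM -Er (monicP mp).
have aL : a * (lead_coef p1)%:~R = 1.
  have := congr1 lead_coef Ep1.
  by rewrite lead_coefXsubC lead_coefZ (lead_coef_map_inj intr_inj (mulr0z 1)).
have aE : a = (lead_coef r)%:~R.
  have nz : (lead_coef p1)%:~R != 0 :> rat.
    by apply: contra_eq_neq aL => ->; rewrite mulr0 eq_sym oner_eq0.
  by apply: (mulIf nz); rewrite aL mulrC L.
have /(congr1 (fun s : {poly rat} => s`_0)) := Ep1.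
rewrite coefB coefX coefC coefZ coef_map /= sub0r aE -intrM => /(canRL (@opprK _)) ->.
by rewrite rpredN intr_int.
Qed.

(** The analogue of the Wronskian criterion for the automorphism [sigma] instead
of a derivation. A relation [v] between the rows, normalized by [v i0 = 1],
yields the relation [sigma v - v], which does not involve the row [i0] and
holds for the last [e - 1] columns. By induction it is trivial: the [v i] are
fixed by [sigma], and the first column contradicts the independence of [x]. *)
Lemma casorati_neq0 (K : fieldType) (sigma : {rmorphism K -> K}) (e : nat)
    (x : 'I_e -> K) :
  (forall c : 'I_e -> K, (forall i, sigma (c i) = c i) ->
     \sum_i c i * x i = 0 -> forall i, c i = 0) ->
  \det (\matrix_(i < e, a < e) iter a sigma (x i)) != 0.
Proof.
elim: e x => [|e IH] x free_x; first by rewrite det_mx00 oner_eq0.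
apply/det0P => -[u u0 uM].
have [i0 ui0] : exists i, u 0 i != 0.
  apply/existsP; apply: contraNT u0; rewrite negb_exists => /forallP u0.
  by apply/eqP/rowP => i; rewrite mxE; apply/eqP; rewrite -[_ == _]negbK.
pose v i := u 0 i / u 0 i0.
have rel (a : 'I_e.+1) : \sum_i v i * iter a sigma (x i) = 0.
  have /rowP/(_ a) := uM; rewrite !mxE => E.
  rewrite (eq_bigr (fun i => (u 0 i0)^-1 *
    (u 0 i * (\matrix_(i < e.+1, a < e.+1) iter a sigma (x i)) i a))).
    by rewrite -mulr_sumr E mulr0.
  by move=> i _; rewrite mxE /v; ring.
pose w i := sigma (v i) - v i.
have relw (a : 'I_e) : \sum_i w i * iter a.+1 sigma (x i) = 0.
  have := congr1 sigma (rel (widen_ord (leqnSn e) a)).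
  rewrite rmorph0 rmorph_sum /= => E1; have /= E2 := rel (lift ord0 a).
  rewrite (eq_bigr (fun i => sigma (v i * iter a sigma (x i)) - v i * sigma (iter a sigma (x i)))).
    by rewrite big_split sumrN /= E1 E2 subrr.
  by move=> i _; rewrite rmorphM mulrBl.
have wi0 : w i0 = 0 by rewrite /w /v divff // rmorph1 subrr.
have det_lift : \det (\matrix_(i < e, a < e) iter a sigma (x (lift i0 i))) != 0.
  apply: IH => c fc sc i.
  pose c' i := if unlift i0 i is Some l then c l else 0.
  have c'f l : sigma (c' l) = c' l.
    by rewrite /c'; case: unliftP => [l' _|_]; rewrite ?fc ?rmorph0.
  have c's : \sum_i c' i * x i = 0.
    rewrite (bigD1_ord i0) //= {1}/c' unlift_none mul0r add0r -[RHS]sc.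
    by apply: eq_bigr => l _; rewrite /c' liftK.
  by have := free_x c' c'f c's (lift i0 i); rewrite /c' liftK.
have w0 i : w i = 0.
  pose w' : 'rV[K]_e := \row_i w (lift i0 i).
  have w'0 : w' *m (\matrix_(i < e, a < e) iter a.+1 sigma (x (lift i0 i))) = 0.
    apply/rowP => a; rewrite !mxE -[RHS](relw a) (bigD1_ord i0) //= wi0 mul0r add0r.
    by apply: eq_bigr => l _; rewrite !mxE.
  have /negP dn : \det (\matrix_(i < e, a < e) iter a.+1 sigma (x (lift i0 i))) != 0.
    rewrite (_ : matrix_of_fun _ _ = map_mx sigma
      (\matrix_(i < e, a < e) iter a sigma (x (lift i0 i)))).
      by rewrite det_map_mx fmorph_eq0.
    by apply/matrixP => i' a; rewrite !mxE.
  have w'E : w' = 0.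
    by apply/eqP; apply: contraT => nz; case: dn; apply/det0P; exists w'.
  case: (unliftP i0 i) => [l ->|-> //].
  by have /rowP/(_ l) := w'E; rewrite !mxE.
have fv i : sigma (v i) = v i by apply/eqP; rewrite -subr_eq0; apply/eqP/w0.
have /eqP := free_x v fv (rel ord0) i0.
by rewrite /v divff // oner_eq0.
Qed.

Lemma rmorph_ratr (L : unitRingType) (g : {rmorphism rat -> L}) q : g q = ratr q.
Proof. by rewrite -(fmorph_rat g) /ratr divq_num_den. Qed.

Section IteratedMorphism.
Variables (K : fieldType) (sigma : {rmorphism K -> K}).

Fixpoint iterm (i : nat) : {rmorphism K -> K} :=
  if i is i'.+1 then sigma \o iterm i' else idfun.

Lemma itermE i x : iterm i x = iter i sigma x.
Proof. by elim: i => //= i ->. Qed.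

End IteratedMorphism.

Lemma horner_rat (K L : fieldType) (g : {rmorphism K -> L})
    (j : {rmorphism rat -> K}) (p : {poly rat}) y :
  g (map_poly j p).[y] = (map_poly ratr p).[g y].
Proof.
rewrite -horner_map -map_poly_comp; congr (_.[_]); apply: eq_map_poly => q /=.
by rewrite rmorph_ratr fmorph_rat.
Qed.


(** A real cyclic extension of degree [2 ^ k] of the rationals, with a generator
[sigma] of its Galois group, a real embedding [iota] and an integral primitive
element [theta]. An element fixed by [sigma] is rational because it is the
value of one polynomial of degree less than [2 ^ k] at the [2 ^ k] conjugates
of [theta]; the norm of a nonzero integral element is fixed by [sigma] and
integral, hence a nonzero integer. *)
Lemma cyclic_real_field (R : realType) (k : nat) : (1 < k)%N ->
  exists (K : fieldType) (j : {rmorphism rat -> K}) (sigma : {rmorphism K -> K})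
      (iota : {rmorphism K -> R}) (theta : K),
  [/\ forall p : {poly rat},
        (size p <= 2 ^ k)%N -> (map_poly j p).[theta] = 0 -> p = 0,
      {in [pred i | (i < 2 ^ k)%N] &, injective (fun i => iter i sigma theta)},
      forall x, sigma x = x -> exists q, x = j q,
      forall x, integralOver (intr : int -> K) x -> x != 0 ->
        1 <= `|\prod_(i < 2 ^ k) iota (iter i sigma x)| &
      integralOver (intr : int -> K) theta].
Proof.
move=> k1; have [K [j [sigma [iota [theta [indep gen inj per int_theta]]]]]] :=
  cheb_field R k1.
exists K, j, sigma, iota, theta.
have iter_horner i p y :
    iter i sigma (map_poly j p).[y] = (map_poly j p).[iter i sigma y].
  rewrite -!itermE horner_rat; congr (_.[_]); apply: eq_map_poly => q.
  by rewrite rmorph_ratr.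
have sigma_per x : iter (2 ^ k) sigma x = x.
  by have [p _ ->] := gen x; rewrite iter_horner per.
have fixed x : sigma x = x -> exists q, x = j q.
  have [p sp xE] := gen x => fx; exists p`_0.
  have fxi i : (map_poly j p).[iter i sigma theta] = x.
    by rewrite -iter_horner -xE; elim: i => //= i ->.
  have pC : map_poly j p = x%:P.
    apply/eqP; rewrite -subr_eq0; apply: contraT => nz.
    have := max_poly_roots nz (rs := [seq iter i sigma theta | i <- seq.iota 0 (2 ^ k)]).
    rewrite size_map size_iota ltnNge.
    have -> : (size (map_poly j p - x%:P)%R <= 2 ^ k)%N.
      rewrite (leq_trans (size_polyD _ _)) // geq_max size_polyN size_map_poly sp.
      by rewrite (leq_trans (size_polyC_leq1 _)) // expn_gt0.
    apply.
      apply/allP => _ /mapP[i _ ->]; rewrite /root !hornerE fxi subrr //.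
    rewrite map_inj_in_uniq ?iota_uniq // => a b.
    by rewrite !mem_iota; apply: inj.
  by rewrite -coef_map pC coefC.
split=> // x intx x0; rewrite -rmorph_prod.
set N := \prod_(i < _) _.
have integral_iter i y : integralOver (intr : int -> K) y ->
    integralOver (intr : int -> K) (iter i sigma y).
  move=> [p mp /rootP rp]; exists p => //; rewrite -itermE; apply/rootP.
  rewrite -[RHS](rmorph0 (iterm sigma i)) -rp -horner_map -map_poly_comp.
  by congr (_.[_]); apply: eq_map_poly => z /=; rewrite rmorph_int.
have intN : integralOver (intr : int -> K) N.
  rewrite /N; elim/big_ind: _ => [|a b|i _]; first exact: integral1.
    exact: integral_mul.
  exact: integral_iter.
have fN : sigma N = N.
  rewrite /N rmorph_prod.
  rewrite -(big_mkord xpredT (fun i => sigma (iter i sigma x))).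
  rewrite -(big_mkord xpredT (fun i => iter i sigma x)).
  rewrite -[in LHS](prednK (expn_gt0 2 k)) -[in RHS](prednK (expn_gt0 2 k)).
  rewrite big_nat_recr //= [RHS]big_nat_recl //= mulrC; congr (_ * _).
  by rewrite -iterS prednK ?expn_gt0 // sigma_per.
have [q qE] := fixed _ fN.
have /intrP[z zE] : q \is a Num.int by apply: (integral_rat_int (j := j)); rewrite -qE.
have N0 : N != 0.
  by apply/prodf_neq0 => i _; rewrite -itermE fmorph_eq0.
rewrite qE zE rmorph_int rmorph_int -intr_norm ler1z -gtz0_ge1 normr_gt0.
by apply: contraNneq N0 => z0; rewrite qE zE z0 rmorph0.
Qed.

(** * Minors, Pluecker coordinates and bounded height *)

(** A form of the Cauchy-Binet formula where the minors are indexed by all maps,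
instead of the increasing ones: it is the mere multilinear expansion. *)
Lemma det_mulmx_sum (A : comPzRingType) (e n : nat) (M : 'M[A]_(e, n))
    (T : 'M[A]_(n, e)) :
  \det (M *m T) =
  \sum_(f : {ffun 'I_e -> 'I_n}) (\prod_a T (f a) a) * \det (colsub f M).
Proof.
rewrite -det_tr {1}/determinant.
under [RHS]eq_bigr do rewrite -det_tr /determinant mulr_sumr.
rewrite exchange_big /=; apply: eq_bigr => s _.
under [in LHS]eq_bigr do rewrite !mxE.
rewrite bigA_distr_bigA mulr_sumr /=; apply: eq_bigr => f _.
rewrite big_split /= [RHS]mulrCA; congr (_ * _).
by rewrite mulrC; congr (_ * _); apply: eq_bigr => i _; rewrite !mxE.
Qed.

(** The position of [i] after sorting is the number of [k] with [f k < f i]. *)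
Lemma sort_ffun (e n : nat) (f : {ffun 'I_e -> 'I_n}) : injective f ->
  exists s : 'S_e, increasing [ffun a => f (s a)].
Proof.
move=> inj_f.
pose below i := [set k : 'I_e | (f k < f i)%N].
have lt_below i : (#|below i| < e)%N.
  rewrite -[X in (_ < X)%N](card_ord e) -cardsT; apply: proper_card.
  apply/properP; split; first by apply/fintype.subsetP => k; rewrite inE.
  by exists i; rewrite ?inE ?ltnn.
have mono i l : (f i < f l)%N -> (#|below i| < #|below l|)%N.
  move=> il; apply: proper_card; apply/properP; split.
    by apply/fintype.subsetP => k; rewrite !inE => /ltn_trans; apply.
  by exists i; rewrite !inE ?ltnn.
have inj_r : injective (fun i => Ordinal (lt_below i)).
  move=> i l [E]; apply: inj_f; apply: val_inj; apply/eqP.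
  by case: ltngtP => // /mono; rewrite E ltnn.
exists (perm inj_r)^-1%g; apply/'forall_'forall_implyP => a b ab.
rewrite !ffunE; set i := (_ a); set l := (_ b).
have Ea : #|below i| = a by rewrite -[in RHS](permKV (perm inj_r) a) permE.
have Eb : #|below l| = b by rewrite -[in RHS](permKV (perm inj_r) b) permE.
rewrite ltnNge leq_eqVlt; apply/negP => /orP[/eqP/val_inj/inj_f E|/mono].
  by move: ab; rewrite -Ea -Eb E ltnn.
by rewrite Ea Eb ltnNge ltnW.
Qed.

Section Pluecker.
Variables (R : realType) (n : nat).
Implicit Types (B : {vspace 'rV[R]_n}).

(** The minor of an arbitrary map is zero, or up to the sign the one of its
increasing rearrangement. Hence all minors share the integrality and the bound
of the Pluecker coordinates. *)
Lemma minors_extend (e : nat) (M : 'M[R]_(e, n)) (c : R)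
    (Xi : {ffun 'I_e -> 'I_n} -> int) :
  (forall f, increasing f -> (Xi f)%:~R = c * \det (colsub f M)) ->
  forall f : {ffun 'I_e -> 'I_n}, exists2 z : int, z%:~R = c * \det (colsub f M) &
    `|z%:~R| <= Num.sqrt (\sum_(g | increasing g) ((Xi g)%:~R : R) ^+ 2).
Proof.
move=> XiE f; case: (boolP (injectiveb f)) => [/injectiveP inj_f | /injectivePn].
  have [s incr] := sort_ffun inj_f; set g := [ffun a => _] in incr.
  have sg : \det (colsub g M) = (-1) ^+ s * \det (colsub f M).
    have -> : colsub g M = col_perm s (colsub f M).
      by apply/matrixP => i j; rewrite !mxE ffunE.
    by rewrite col_permE det_mulmx det_perm odd_permV mulrC.
  have E : ((-1) ^+ s * Xi g)%:~R = (-1) ^+ s * (Xi g)%:~R :> R.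
    by rewrite intrM intr_sign.
  exists ((-1) ^+ s * Xi g); rewrite E.
    by rewrite XiE // sg mulrCA [X in _ * X]mulrA -signr_addb addbb mul1r.
  rewrite normrMsign -sqrtr_sqr ler_wsqrtr //.
  by rewrite (bigD1 g) //= lerDl sumr_ge0 // => h _; exact: sqr_ge0.
move=> [a [b ab fab]]; exists 0; last by rewrite normr0 sqrtr_ge0.
rewrite -det_tr (determinant_alternate ab) ?mulr0 // => i.
by rewrite !mxE fab.
Qed.

(** A nonzero height is not the default value, so that it comes from actual
Pluecker coordinates. *)
Lemma height_pluecker B (e : nat) : \dim B = e -> height B != 0 ->
  exists (M : 'M[R]_(e, n)) (c : R) (z : {ffun {ffun 'I_e -> 'I_n} -> int}),
  [/\ basis_of B [seq row i M | i <- enum 'I_e], c != 0,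
      forall f, (z f)%:~R = c * \det (colsub f M),
      forall f, `|(z f)%:~R| <= height B & exists f, z f != 0].
Proof.
move=> <- {e}; rewrite /height; case: xgetP => [_ ->|_]; last by rewrite eqxx.
move=> [Xi [[[M [c [bM c0 XiE]]] gcd1] ->]] _.
have zE f := cid2 (minors_extend XiE f).
exists M, c, [ffun f => s2val (zE f)]; split=> // [f|f|].
- by rewrite ffunE (s2valP (zE f)).
- by rewrite ffunE (s2valP' (zE f)).
have [f incr Xi0] : exists2 f, increasing f & Xi f != 0.
  apply/exists_inP; apply: contraT; rewrite negb_exists_in => /forall_inP Xi0.
  have : (0 %| \big[gcdn/0%N]_(f | increasing f) `|Xi f|%N)%N.
    apply: (big_ind (fun m => (0 %| m)%N)) => // [a b|f incr].
      by rewrite dvdn_gcd => -> ->.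
    by have := Xi0 f incr; rewrite negbK => /eqP ->.
  by rewrite gcd1.
exists f; rewrite ffunE; apply: contraNneq Xi0 => z0.
by rewrite -(intr_eq0 R) XiE // -(s2valP (zE f)) z0.
Qed.

Lemma span_rows_mulmx (e l : nat) (U : 'M[R]_(l, e)) (M : 'M[R]_(e, n)) :
  (<<[seq row i (U *m M) | i <- enum 'I_l]>> <= <<[seq row i M | i <- enum 'I_e]>>)%VS.
Proof.
apply/span_subvP => _ /mapP[i _ ->].
rewrite row_mul mulmx_sum_row; apply: memv_suml => a _; apply: memvZ.
by apply: memv_span; apply: map_f; rewrite mem_enum.
Qed.

(** The span of the rows of [\adj P *m M], up to a scalar, when [z] is proportional
to the minors of [M] and [P] consists of the columns of [M] selected by [f]:
by Cramer's rule, an entry of this product is the minor of [M] where one column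
of [P] has been replaced. *)
Definition subspace_of_minors (e : nat) (z : {ffun 'I_e -> 'I_n} -> int)
    (f : {ffun 'I_e -> 'I_n}) : {vspace 'rV[R]_n} :=
  <<[seq \row_j (z [ffun a => if a == i then j else f a])%:~R | i <- enum 'I_e]>>%VS.

Lemma subspace_of_minorsE B (e : nat) (M : 'M[R]_(e, n)) (c : R)
    (z : {ffun 'I_e -> 'I_n} -> int) (f : {ffun 'I_e -> 'I_n}) :
  basis_of B [seq row i M | i <- enum 'I_e] ->
  (forall f, (z f)%:~R = c * \det (colsub f M)) -> z f != 0 ->
  B = subspace_of_minors z f.
Proof.
move=> /span_basis <- zE zf0; pose P := colsub f M.
have cdetP : c * \det P != 0 by rewrite -zE intr_eq0.
have [c0 dP] : c != 0 /\ \det P != 0 by apply/andP; rewrite -negb_or -mulf_eq0.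
pose E := (c *: \adj P) *m M.
have rowE i : \row_j (z [ffun a => if a == i then j else f a])%:~R = row i E.
  apply/rowP => j; rewrite !mxE zE (expand_det_col _ i) mulr_sumr.
  apply: eq_bigr => l _; rewrite !mxE ffunE eqxx mulrCA mulrC; congr (_ * _ * _).
  congr (_ * \det _); apply/matrixP => a b; rewrite !mxE ffunE.
  by rewrite eq_sym (negPf (neq_lift _ _)).
rewrite /subspace_of_minors (eq_map rowE); apply/eqP; rewrite eqEsubv span_rows_mulmx andbT.
have -> : M = (c * \det P)^-1 *: P *m E.
  rewrite /E mulmxA -scalemxAl -scalemxAr mul_mx_adj scalerA.
  by rewrite scale_scalar_mx -mulrA mulVf // mul1mx.
exact: span_rows_mulmx.
Qed.

Local Open Scope classical_set_scope.
Local Open Scope ring_scope.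

(** By [subspace_of_minorsE], a subspace is determined by its integer minors, which
are bounded by the height. *)
Lemma finite_bounded_height (e : nat) (h : R) :
  finite_set [set B : {vspace 'rV[R]_n} | [/\ \dim B = e, height B != 0 & height B <= h]].
Proof.
(* a minor lies between - N and N, hence is encoded, shifted by N, in a finite type *)
pose N := Num.truncn h.
pose code := {ffun {ffun 'I_e -> 'I_n} -> 'I_(N + N).+1}.
pose Z (w : code) (f : {ffun 'I_e -> 'I_n}) : int := (w f)%:Z - N%:Z.
apply: (@sub_finite_set _ _ [set subspace_of_minors (Z p.1) p.2 |
  p in [set: code * {ffun 'I_e -> 'I_n}]]); last first.
  by apply: finite_image; exact: finite_finset.
move=> B [dB h0 hh]; have [M [c [z [bM c0 zE zh [f zf]]]]] := height_pluecker dB h0.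
have zN g : (`|z g| <= N)%N.
  rewrite /N truncn_ge_nat; last by rewrite (le_trans _ hh) // (le_trans _ (zh f)).
  by rewrite (le_trans _ hh) // (le_trans _ (zh g)) // -intr_norm natr_absz.
have ZE : z =1 Z [ffun g => inord `|z g + N%:Z|].
  move=> g; rewrite /Z ffunE inordK; last by have := zN g; lia.
  by have := zN g; lia.
exists ([ffun g => inord `|z g + N%:Z|], f) => //=.
have zE' g : (Z [ffun g => inord `|z g + N%:Z|] g)%:~R = c * \det (colsub g M) by rewrite -ZE.
by apply/esym/(subspace_of_minorsE bM zE'); rewrite -ZE.
Qed.
End Pluecker.

(** * Existence of the first principal angle *)

Section Angle.
Import numFieldNormedType.Exports.
Local Open Scope classical_set_scope.
Local Open Scope ring_scope.
Variables (R : realType) (n : nat).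
Local Notation V := 'rV[R]_n.
Implicit Types (X Y : V) (A B : {vspace V}).

Lemma sum_continuous (T : topologicalType) (I : Type) (r : seq I) (P : pred I)
    (F : I -> T -> R) :
  (forall i, continuous (F i)) -> continuous (fun x => \sum_(i <- r | P i) F i x).
Proof.
move=> cF x; apply: cvg_big => //; first exact: add_continuous.
by move=> i _; exact: cF.
Qed.

Lemma entry_continuous (i : 'I_n) : continuous (fun X : V => X 0 i).
Proof. exact: coord_continuous. Qed.

Lemma enorm_continuous : continuous (@enorm R n).
Proof.
move=> X; apply: (continuous_comp (f := fun X => dotv X X) (g := Num.sqrt)).
  by apply: sum_continuous => i Y; apply: continuousM; exact: entry_continuous.
exact: sqrt_continuous.
Qed.

Lemma wedge_norm_continuous : continuous (fun p : V * V => wedge_norm p.1 p.2).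
Proof.
have c1 i : continuous (fun p : V * V => p.1 0 i).
  by move=> p; apply: (continuous_comp (f := fst) (g := fun X : V => X 0 i));
    [exact: cvg_fst | exact: entry_continuous].
have c2 i : continuous (fun p : V * V => p.2 0 i).
  by move=> p; apply: (continuous_comp (f := snd) (g := fun X : V => X 0 i));
    [exact: cvg_snd | exact: entry_continuous].
move=> p; apply: (continuous_comp (f := fun p : V * V => \sum_(i < n) \sum_(j < n | (i < j)%N)
   (p.1 0 i * p.2 0 j - p.1 0 j * p.2 0 i) ^+ 2) (g := Num.sqrt)); last exact: sqrt_continuous.
apply: sum_continuous => i; apply: sum_continuous => j q.
apply: (continuous_comp (f := fun p : V * V => p.1 0 i * p.2 0 j - p.1 0 j * p.2 0 i)
  (g := fun x : R => x ^+ 2)); last exact: exprn_continuous.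
by apply: continuousB; apply: continuousM; (apply: c1 || apply: c2).
Qed.

Lemma entry_le_enorm X i : `|X 0 i| <= enorm X.
Proof.
rewrite -sqrtr_sqr ler_wsqrtr // /dotv (bigD1 i) //= -expr2 lerDl.
by apply: sumr_ge0 => l _; rewrite -expr2 sqr_ge0.
Qed.

Lemma enorm_eq0 X : enorm X = 0 -> X = 0.
Proof.
move=> X0; apply/rowP => i; apply/eqP; rewrite mxE -normr_le0 -X0.
exact: entry_le_enorm.
Qed.

Lemma enorm1_neq0 X : enorm X = 1 -> X != 0.
Proof.
move=> X1; apply: contra_eq_neq X1 => ->; rewrite eq_sym /enorm /dotv big1.
  by rewrite sqrtr0 oner_eq0.
by move=> i _; rewrite mxE mul0r.
Qed.

Lemma dotv_ge0 X : 0 <= dotv X X.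
Proof. by apply: sumr_ge0 => i _; rewrite -expr2 sqr_ge0. Qed.

Lemma enormZ a X : enorm (a *: X) = `|a| * enorm X.
Proof.
rewrite /enorm -sqrtr_sqr -sqrtrM ?sqr_ge0 //; congr Num.sqrt.
by rewrite /dotv mulr_sumr; apply: eq_bigr => i _; rewrite !mxE; ring.
Qed.

Lemma wedge_normZ a b X Y : wedge_norm (a *: X) (b *: Y) = `|a * b| * wedge_norm X Y.
Proof.
rewrite /wedge_norm -sqrtr_sqr -sqrtrM ?sqr_ge0 //; congr Num.sqrt.
rewrite mulr_sumr; apply: eq_bigr => i _; rewrite mulr_sumr; apply: eq_bigr => j _.
by rewrite !mxE; ring.
Qed.

Lemma enorm_unit X : X != 0 -> enorm ((enorm X)^-1 *: X) = 1.
Proof.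
move=> X0; have nX : enorm X != 0 by apply: contra_neq X0; exact: enorm_eq0.
by rewrite enormZ ger0_norm ?invr_ge0 ?sqrtr_ge0 // mulVf.
Qed.

(** [A] is the kernel of the identity minus the projection onto [A]. *)
Lemma closed_vspace A : closed [set X | X \in A].
Proof.
pose P := lin1_mx (\1 - projv A)%VF.
have AE : [set X | X \in A] = (fun X => dotv (X *m P) (X *m P)) @^-1` [set 0].
  apply/seteqP; split => X /=; rewrite mul_rV_lin1 /= add_lfunE id_lfunE opp_lfunE.
    by move=> /projv_id ->; rewrite subrr /dotv big1 // => i _; rewrite mxE mul0r.
  move=> d0; have /enorm_eq0/eqP : enorm (X - projv A X) = 0 by rewrite /enorm d0 sqrtr0.
  by rewrite subr_eq0 => /eqP ->; exact: memv_proj.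
rewrite AE; apply: preimage_closed; last exact: closed_eq.
move=> X _; rewrite /dotv.
have cP i : continuous (fun X : V => (X *m P) 0 i).
  rewrite (_ : (fun _ => _) = fun X => \sum_l X 0 l * P l i).
    apply: sum_continuous => l Y; apply: continuousM; first exact: entry_continuous.
    exact: cst_continuous.
  by apply/funext => Y; rewrite mxE.
by apply: sum_continuous => i Y; apply: continuousM; exact: cP.
Qed.

Lemma compact_unit_sphere A : compact [set X | X \in A /\ enorm X = 1].
Proof.
apply: bounded_closed_compact.
  exists 1; split; first exact: real1.
  move=> x x1 X [_ X1]; rewrite /Num.Def.normr /= mx_normrE; apply/bigmax_leP.
  split; first by apply: le_trans (ltW x1).
  move=> [a i] _ /=; rewrite ord1 (le_trans (entry_le_enorm X i)) // X1.
  exact: ltW.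
apply: closedI; first exact: closed_vspace.
apply: (preimage_closed (f := @enorm R n) (D := [set 1])); last exact: closed_eq.
by move=> X _; exact: enorm_continuous.
Qed.

(** The minimum exists by compactness of the unit spheres of [A] and [B], since
[psi] is invariant under scaling; hence the default value of the choice in
[principal_pairs] does not occur. *)
Lemma psi_angle1 A B : (0 < \dim A)%N -> (0 < \dim B)%N ->
  exists X Y, [/\ X \in A, Y \in B, enorm X = 1, enorm Y = 1 &
    psi_angle 1 A B = wedge_norm X Y].
Proof.
move=> A0 B0.
pose S (C : {vspace V}) := [set X : V | X \in C /\ enorm X = 1].
have unit (C : {vspace V}) : (0 < \dim C)%N -> S C !=set0.
  rewrite lt0n dimv_eq0 -vpick0 => C0; exists ((enorm (vpick C))^-1 *: vpick C).
  by split; [apply: memvZ; exact: memv_pick | exact: enorm_unit].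
have [[X0 SX0] [Y0 SY0]] := (unit A A0, unit B B0).
have [|||p pS minp] := @compact_EVT_min _ R (fun p : V * V => wedge_norm p.1 p.2) (S A `*` S B).
- by exists (X0, Y0).
- by apply: compact_setX; exact: compact_unit_sphere.
- by apply: continuous_subspaceT; exact: wedge_norm_continuous.
have psi1 X Y : enorm X = 1 -> enorm Y = 1 -> psi X Y = wedge_norm X Y.
  by move=> X1 Y1; rewrite /psi X1 Y1 mulr1 divr1.
have : minimizing A B [::] p.
  move: pS; rewrite inE => -[[pA p1] [pB p2]]; split=> //.
    by split=> //; exact: enorm1_neq0.
  move=> q [qA qA0 qB qB0 _]; rewrite psi1 //.
  pose q' := ((enorm q.1)^-1 *: q.1, (enorm q.2)^-1 *: q.2).
  have -> : psi q.1 q.2 = wedge_norm q'.1 q'.2.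
    rewrite wedge_normZ /psi mulrC -invfM ger0_norm //.
    by rewrite invr_ge0 mulr_ge0 // sqrtr_ge0.
  apply: minp; rewrite inE; split; split=> /=; try exact: memvZ; exact: enorm_unit.
move=> min_p; have := xgetPex (0, 0) (ex_intro _ p min_p); rewrite /psi_angle /=.
move: (xget _ _) => -[X Y] /= [[/= XA _ YB _ _] X1 Y1 _].
by exists X, Y; split=> //; exact: psi1.
Qed.
End Angle.

(** * Upper bounds for determinants of linear forms *)

Section Bounds.
Variables (R : realType) (n : nat).
Local Notation V := 'rV[R]_n.
Implicit Types (X Y : V) (A B : {vspace V}).

Lemma minor_le_wedge_norm X Y i j :
  `|X 0 i * Y 0 j - X 0 j * Y 0 i| <= wedge_norm X Y.
Proof.
wlog ij : i j / (i < j)%N => [W|].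
  case: (ltngtP i j) => [|ji|/val_inj ->]; first exact: W.
    by rewrite distrC W.
  by rewrite subrr normr0 sqrtr_ge0.
rewrite -sqrtr_sqr ler_wsqrtr // (bigD1 i) //= (bigD1 j) //= -addrA lerDl.
by rewrite addr_ge0 // !sumr_ge0 // => *; rewrite ?sumr_ge0 // => *; exact: sqr_ge0.
Qed.

Lemma enorm1_sum X : enorm X = 1 -> \sum_i X 0 i * X 0 i = 1.
Proof.
by move=> X1; rewrite -[RHS](expr1n _ 2) -X1 /enorm sqr_sqrtr // dotv_ge0.
Qed.

Lemma psi_angle1_gt0 A B : (0 < \dim A)%N -> (0 < \dim B)%N ->
  \dim (A :&: B) = 0%N -> 0 < psi_angle 1 A B.
Proof.
move=> A0 B0 AB0; have [X [Y [XA YB X1 Y1 ->]]] := psi_angle1 A0 B0.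
rewrite lt0r sqrtr_ge0 andbT; apply/negP => /eqP w0.
have prop i j : Y 0 i * X 0 j = X 0 i * Y 0 j.
  apply/eqP; rewrite -subr_eq0 -normr_le0 -w0 mulrC distrC.
  by rewrite (le_trans _ (minor_le_wedge_norm X Y i j)).
have YE : Y = (\sum_j X 0 j * Y 0 j) *: X.
  apply/rowP => i; rewrite mxE -[LHS]mulr1 -(enorm1_sum X1) mulr_sumr mulr_suml.
  by apply: eq_bigr => j _; rewrite mulrA prop; ring.
have : Y \in (A :&: B)%VS by rewrite memv_cap YB andbT YE memvZ.
move/eqP: AB0; rewrite dimv_eq0 => /eqP ->; rewrite memv0.
by rewrite (negPf (enorm1_neq0 Y1)).
Qed.

(** For a linear form [L] that vanishes at [X], the number [L(Y) X_j] equals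
[L(Y) X_j - L(X) Y_j], a combination of the coordinates of the wedge product;
multiply it by [X_j] and sum over [j], as [X] is a unit vector. *)
Lemma linear_form_le_wedge (q : nat) (T : 'M[R]_(n, q)) (K : R) X Y a :
  (forall k a, `|T k a| <= K) -> enorm X = 1 -> (X *m T) 0 a = 0 ->
  `|(Y *m T) 0 a| <= n%:R ^+ 2 * K * wedge_norm X Y.
Proof.
move=> TK X1 XT; set L := (Y *m T) 0 a; set w := wedge_norm X Y.
have step j : `|L * X 0 j| <= n%:R * K * w.
  have -> : L * X 0 j = \sum_i T i a * (Y 0 i * X 0 j - Y 0 j * X 0 i).
    transitivity (L * X 0 j - (X *m T) 0 a * Y 0 j); first by rewrite XT mul0r subr0.
    rewrite /L !mxE !mulr_suml -sumrB; apply: eq_bigr => i _; ring.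
  apply: le_trans (ler_norm_sum _ _ _) _.
  rewrite -mulrA -[n in n%:R](card_ord n) mulr_natl -sumr_const; apply: ler_sum => i _.
  rewrite normrM ler_pM //.
  by rewrite mulrC [Y 0 j * _]mulrC; exact: (minor_le_wedge_norm X Y j i).
have -> : L = \sum_j (L * X 0 j) * X 0 j.
  rewrite -[LHS]mulr1 -(enorm1_sum X1) mulr_sumr; apply: eq_bigr => j _; ring.
apply: le_trans (ler_norm_sum _ _ _) _.
have sumE (z : R) : n%:R * z = \sum_(i < n) z by rewrite sumr_const card_ord mulr_natl.
rewrite expr2 -!mulrA sumE.
apply: ler_sum => j _; rewrite normrM -[leRHS]mulr1 ler_pM // ?mulrA //.
by rewrite -X1; exact: entry_le_enorm.
Qed.

Lemma prod_diff_le (e : nat) (x y : 'I_e -> R) (K delta : R) : 1 <= K ->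
  (forall a, `|x a| <= K) -> (forall a, `|y a| <= K) ->
  (forall a, `|x a - y a| <= delta) ->
  `|\prod_a x a - \prod_a y a| <= e%:R * K ^+ e * delta.
Proof.
move=> K1; elim: e x y => [|e IH] x y xK yK xy.
  by rewrite !big_ord0 subrr normr0 !mul0r.
have K0 : 0 <= K by apply: le_trans K1.
have d0 : 0 <= delta by apply: le_trans (xy ord0).
rewrite !big_ord_recl.
set P := \prod_(i < e) _; set Q := \prod_(i < e) _.
have -> : x ord0 * P - y ord0 * Q = (x ord0 - y ord0) * P + y ord0 * (P - Q) by ring.
have PK : `|P| <= K ^+ e.
  rewrite /P normr_prod -[e in K ^+ e](card_ord e) -prodr_const.
  by apply: ler_prod => i _; rewrite normr_ge0 xK.
have PQ : `|P - Q| <= e%:R * K ^+ e * delta by apply: IH.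
apply: le_trans (ler_normD _ _) _; rewrite !normrM -natr1 !mulrDl mul1r addrC exprS.
apply: lerD.
  have -> : e%:R * (K * K ^+ e) * delta = K * (e%:R * K ^+ e * delta) by ring.
  by rewrite ler_pM.
rewrite mulrC ler_pM // (le_trans PK) // ler_peMl // exprn_ge0 //.
Qed.

Section MinorSum.
Variables (e : nat) (M : 'M[R]_(e, n)) (c H K : R) (T : 'M[R]_(n, e)).
Hypotheses (MH : forall f : {ffun 'I_e -> 'I_n}, `|c * \det (colsub f M)| <= H)
  (K1 : 1 <= K) (TK : forall k a, `|T k a| <= K).

Local Notation F := (#|{ffun 'I_e -> 'I_n}|%:R : R).

Lemma det_mulmx_le : `|c * \det (M *m T)| <= F * K ^+ e * H.
Proof.
rewrite det_mulmx_sum mulr_sumr; apply: le_trans (ler_norm_sum _ _ _) _.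
rewrite -mulrA mulr_natl -sumr_const; apply: ler_sum => f _.
rewrite mulrCA normrM ler_pM // normr_prod -[e in K ^+ e](card_ord e) -prodr_const.
by apply: ler_prod => i _; rewrite normr_ge0 TK.
Qed.

(** Here [Y = v *m M] is a unit vector of the row space of [M] on which the linear
forms given by the columns of [T] are small. Subtracting from [T] the rank one
matrix [Y^T *m (Y *m T)], whose entries are small, makes these forms vanish at
[Y] and the determinant equal to 0; compare the two determinants term by term in
the expansion [det_mulmx_sum], whose minors are bounded by [H]. *)
Lemma det_mulmx_small_le (v : 'rV[R]_e) (delta : R) : v != 0 ->
  enorm (v *m M) = 1 -> (forall a, `|(v *m M *m T) 0 a| <= delta) ->
  `|c * \det (M *m T)| <= F * (e%:R * (n.+1%:R * K) ^+ e * delta) * H.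
Proof.
set Y := v *m M => v0 Y1 Yd; pose T' := T - Y^T *m (Y *m T).
have YY : Y *m Y^T = 1%:M.
  apply/matrixP => i j; rewrite !ord1 mxE [RHS]mxE /= -[RHS](enorm1_sum Y1).
  by apply: eq_bigr => l _; rewrite [Y^T _ _]mxE.
have det0 : \det (M *m T') = 0.
  apply/eqP/det0P; exists v => //.
  by rewrite mulmxA -/Y /T' mulmxBr [Y *m (Y^T *m _)]mulmxA YY mul1mx subrr.
have rank1 (X : 'rV[R]_n) (W : 'rV[R]_e) k a :
    T k a - (T - X^T *m W) k a = X 0 k * W 0 a.
  by rewrite !mxE big_ord1 !mxE; ring.
have Ydiff k a : T k a - T' k a = Y 0 k * (Y *m T) 0 a by exact: rank1.
have Yk k : `|Y 0 k| <= 1 by rewrite -Y1; exact: entry_le_enorm.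
have YTK a : `|(Y *m T) 0 a| <= n%:R * K.
  rewrite mxE; apply: le_trans (ler_norm_sum _ _ _) _.
  rewrite -[n in n%:R](card_ord n) mulr_natl -sumr_const; apply: ler_sum => i _.
  by rewrite normrM -[K]mul1r ler_pM.
(* n.+1 * K bounds the entries of T' as well as those of T *)
have nK1 : 1 <= n.+1%:R * K by rewrite -[leLHS]mulr1 ler_pM // ler1n.
have K0 : 0 <= K by apply: le_trans K1.
have -> : c * \det (M *m T) = \sum_(f : {ffun 'I_e -> 'I_n})
    (\prod_a T (f a) a - \prod_a T' (f a) a) * (c * \det (colsub f M)).
  transitivity (c * \det (M *m T) - c * \det (M *m T')).
    by rewrite det0 mulr0 subr0.
  rewrite !det_mulmx_sum !mulr_sumr -sumrB.
  by apply: eq_bigr => f _; ring.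
apply: le_trans (ler_norm_sum _ _ _) _.
rewrite -[F * _ * H]mulrA mulr_natl -sumr_const; apply: ler_sum => f _.
rewrite normrM ler_pM // prod_diff_le // => a.
- by rewrite (le_trans (TK _ _)) // ler_peMl // ler1n.
- have -> : T' (f a) a = T (f a) a - (T (f a) a - T' (f a) a) by ring.
  rewrite Ydiff (le_trans (ler_normB _ _)) // -natr1 mulrDl mul1r addrC lerD //.
  by rewrite normrM -[leRHS]mul1r ler_pM.
by rewrite Ydiff normrM -[leRHS]mul1r ler_pM.
Qed.
End MinorSum.
End Bounds.

(** * The common kernel of consecutive conjugates *)

Lemma basis_rows (F : fieldType) (e n : nat) (M : 'M[F]_(e, n)) (B : {vspace 'rV[F]_n}) :
  basis_of B [seq row i M | i <- enum 'I_e] ->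
  [/\ forall v : 'rV_e, v *m M = 0 -> v = 0,
      forall v : 'rV_e, v *m M \in B &
      forall Y, Y \in B -> exists v : 'rV_e, Y = v *m M].
Proof.
pose X := [tuple row i M | i < e].
have XE : [seq row i M | i <- enum 'I_e] = X by rewrite /= -val_ord_tuple.
have nthX (i : 'I_e) : X`_i = row i M by rewrite -tnth_nth tnth_mktuple.
have sumX (v : 'rV_e) : v *m M = \sum_(i < e) v 0 i *: X`_i.
  by rewrite mulmx_sum_row; apply: eq_bigr => i _; rewrite nthX.
rewrite XE => /andP[/eqP <- freeX]; split=> [v vM | v | Y YX].
- apply/rowP => i; rewrite mxE; move/freeP: freeX => /(_ (fun i => v 0 i)); apply.
  by rewrite -sumX.
- rewrite sumX; apply: memv_suml => i _; apply: memvZ; apply: memv_span.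
  by rewrite mem_nth // size_tuple.
exists (\row_i coord X i Y); rewrite sumX (coord_span YX).
by apply: eq_bigr => i _; rewrite mxE -coord_span.
Qed.

Section Construction.
Variables (R : realType) (K : fieldType) (j : {rmorphism rat -> K})
  (sigma : {rmorphism K -> K}) (iota : {rmorphism K -> R}) (theta : K) (m n : nat).
Hypotheses (nm : (n <= m)%N)
  (indep : forall p : {poly rat},
     (size p <= m)%N -> (map_poly j p).[theta] = 0 -> p = 0)
  (orbit_inj : {in [pred i | (i < m)%N] &, injective (fun i => iter i sigma theta)})
  (fixed_rat : forall x, sigma x = x -> exists q, x = j q)
  (norm_ge1 : forall x, integralOver (intr : int -> K) x -> x != 0 ->
     1 <= `|\prod_(i < m) iota (iter i sigma x)|)
  (int_theta : integralOver (intr : int -> K) theta).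
Local Notation V := 'rV[R]_n.

(** The column [a] is the real linear form that extends the [i + a]-th conjugate
of the map [X |-> \sum_l X_l theta ^ l] on rational vectors. *)
Definition conj_powers (i q : nat) : 'M[R]_(n, q) :=
  \matrix_(l < n, a < q) iota (iter (i + a) sigma theta) ^+ l.

Definition conj_kernel (d : nat) : {vspace V} :=
  lker (linfun (mulmxr (conj_powers 0 d)) : 'Hom(V, 'rV[R]_d)).

Lemma mem_conj_kernel d X : (X \in conj_kernel d) = (X *m conj_powers 0 d == 0).
Proof. by rewrite memv_ker lfunE. Qed.

(** The forms are independent, by the Vandermonde determinant of the distinct
conjugates of [theta]. *)
Lemma dim_conj_kernel d : (d <= n)%N -> \dim (conj_kernel d) = (n - d)%N.
Proof.
move=> dn; pose W : 'M[R]_d := Vandermonde d (\row_a iota (iter a sigma theta)).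
have unitW : W \in unitmx.
  rewrite unitmxE unitfE det_Vandermonde.
  apply/prodf_neq0 => a _; apply/prodf_neq0 => b ab; rewrite !mxE subr_eq0.
  apply: contraTneq ab => /fmorph_inj E; rewrite -leqNgt.
  by rewrite -(orbit_inj _ _ E) // inE (leq_trans (ltn_ord _)) // (leq_trans dn).
pose U : 'M[R]_(d, n) := invmx W *m rowsub (widen_ord dn) 1%:M.
have UP : U *m conj_powers 0 d = 1%:M.
  rewrite -mulmxA -rowsubE -(mulVmx unitW); congr (_ *m _).
  by apply/matrixP => l a; rewrite !mxE.
pose L : 'Hom(V, 'rV[R]_d) := linfun (mulmxr (conj_powers 0 d)).
have := limg_ker_dim L fullv; rewrite capfv -/(conj_kernel d).
have -> : (L @: fullv)%VS = fullv.
  apply/vspaceP => y; rewrite memvf.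
  have -> : y = L (y *m U).
    by rewrite lfunE /= -mulmxA UP mulmx1.
  by rewrite memv_img // memvf.
by rewrite !dimvf /dim /= !mul1n => E; rewrite -[in RHS]E addnK.
Qed.

(** A rational basis of [B] corresponds to elements of [K] that are independent
over the rationals, because [n <= m]; then [casorati_neq0] says that [e]
consecutive conjugates are independent as linear forms on [B]. *)
Lemma rational_conj_neq0 (B : {vspace V}) (e : nat) (Y : V) :
  @rational_subspaces R n e B -> Y \in B -> Y *m conj_powers 0 e = 0 -> Y = 0.
Proof.
move=> [[s bs] dB] YB Y0.
have ss : size s = e.
  by have /andP[/eqP spanB /eqP sizeB] := bs; rewrite -dB -spanB sizeB size_map.
pose N : 'M[rat]_(e, n) := \matrix_(i < e) s`_i.
have sE : [seq map_mx ratr v | v <- s] = [seq row i (map_mx (ratr : rat -> R) N) | i <- enum 'I_e].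
  apply: (@eq_from_nth _ 0); first by rewrite size_map [RHS]size_map size_enum_ord.
  move=> i; rewrite size_map ss => ie.
  rewrite (nth_map 0) ?ss // (nth_map (Ordinal ie)) ?size_enum_ord //.
  by apply/rowP => l; rewrite !mxE /= nth_enum_ord.
rewrite sE in bs; have [freeN _ spanN] := basis_rows bs.
have [w YE] := spanN Y YB.
pose x (i : 'I_e) : K := (map_poly j (rVpoly (row i N))).[theta].
have conj_x a i : iota (iter a sigma (x i)) = \sum_l ratr (N i l) * iota (iter a sigma theta) ^+ l.
  rewrite -itermE /x [LHS](horner_rat (iota \o iterm sigma a) j (rVpoly (row i N)) theta) /= itermE.
  have sz : (size (map_poly (ratr : rat -> R) (rVpoly (row i N))) <= n)%N.
    by rewrite size_map_poly size_poly.
  rewrite (horner_coef_wide _ sz); apply: eq_bigr => l _.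
  by rewrite coef_map coef_rVpoly_ord mxE.
have det_x : \det (\matrix_(i < e, a < e) iter a sigma (x i)) != 0.
  apply: casorati_neq0 => c fc cx.
  have [q cE] : exists q : 'I_e -> rat, forall i, c i = j (q i).
    pose q i := cid (fixed_rat (fc i)).
    by exists (fun i => sval (q i)) => i; exact: svalP (q i).
  pose u : 'rV[rat]_e := \row_i q i.
  have uN : u *m N = 0.
    rewrite -[LHS]rVpolyK [rVpoly _](indep _ _) ?linear0 //.
      by rewrite (leq_trans _ nm) // size_poly.
    rewrite mulmx_sum_row linear_sum /= rmorph_sum horner_sum -[RHS]cx.
    by apply: eq_bigr => i _; rewrite linearZ /= map_polyZ hornerZ cE mxE.
  have : map_mx (ratr : rat -> R) u = 0.
    by apply: freeN; rewrite -map_mxM uN map_mx0.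
  move=> /rowP u0 i; have /eqP := u0 i; rewrite !mxE fmorph_eq0 => /eqP q0.
  by rewrite cE q0 rmorph0.
have w0 : w = 0.
  apply/eqP; apply: contraNT det_x => w0; rewrite -(fmorph_eq0 iota) -det_map_mx.
  apply/det0P; exists w => //; rewrite -[RHS]Y0 YE -mulmxA; congr (_ *m _).
  apply/matrixP => i a; rewrite !mxE conj_x.
  by apply: eq_bigr => l _; rewrite !mxE.
by rewrite YE w0 mul0mx.
Qed.

Lemma conj_kernel_irrational d e : (0 < d)%N -> (e <= d)%N -> (n = d + d)%N ->
  @irrational_subspaces R n d e 1 (conj_kernel d).
Proof.
move=> d0 ed nE; split; first by rewrite dim_conj_kernel nE ?leq_addr ?addnK.
move=> B ratB; rewrite ltnS leqn0 dimv_eq0 -subv0; apply/subvP => Y.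
rewrite memv_cap mem_conj_kernel memv0 => /andP[/eqP Y0 YB]; apply/eqP.
apply: (rational_conj_neq0 ratB YB); apply/rowP => a.
have /rowP/(_ (widen_ord ed a)) := Y0; rewrite !mxE => E.
by rewrite -[RHS]E; apply: eq_bigr => l _; rewrite !mxE.
Qed.

Section PlueckerNorm.
Variables (e : nat) (B : {vspace V}) (M : 'M[R]_(e, n)) (c : R)
  (z : {ffun {ffun 'I_e -> 'I_n} -> int}).
Hypotheses (ratB : @rational_subspaces R n e B)
  (bM : basis_of B [seq row i M | i <- enum 'I_e]) (c0 : c != 0)
  (zE : forall f, (z f)%:~R = c * \det (colsub f M)).

(** By [det_mulmx_sum], the factors are the absolute values of the conjugates of one
element [D] of the ring generated by [theta], a combination of powers with the
integer minors as coefficients; it is nonzero by [rational_conj_neq0]. *)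
Lemma prod_det_conj_ge1 : 1 <= \prod_(i < m) `|c * \det (M *m conj_powers i e)|.
Proof.
pose D : K := \sum_(f : {ffun 'I_e -> 'I_n})
  (z f)%:~R * \prod_(a < e) iter a sigma theta ^+ f a.
have iota_D i : iota (iter i sigma D) = c * \det (M *m conj_powers i e).
  rewrite -itermE -[LHS]/((iota \o iterm sigma i) D) rmorph_sum /=.
  rewrite det_mulmx_sum mulr_sumr; apply: eq_bigr => f _.
  rewrite !rmorphM !rmorph_int !rmorph_prod mulrCA zE mulrC; congr (_ * _).
  by apply: eq_bigr => a _; rewrite !rmorphXn mxE itermE iterD.
have intD : integralOver (intr : int -> K) D.
  have intM := @integral_mul int K intr.
  rewrite /D; elim/big_ind: _ => [|a b|f _]; first exact: mxpoly.integral0.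
    exact: integral_add.
  apply: (intM); first exact: integral_id.
  elim/big_ind: _ => [|a b|a _]; [exact: integral1 | exact: intM |].
  elim: (nat_of_ord (f a)) => [|l IH]; first exact: integral1.
  rewrite exprS; apply: (intM) => //.
  have [p mp /rootP rp] := int_theta; exists p => //; rewrite -itermE; apply/rootP.
  rewrite -[RHS](rmorph0 (iterm sigma a)) -rp -horner_map -map_poly_comp.
  by congr (_.[_]); apply: eq_map_poly => y /=; rewrite rmorph_int.
have D0 : D != 0.
  apply/negP => /eqP D0; have := iota_D 0%N; rewrite D0 rmorph0 => /esym/eqP.
  rewrite mulf_eq0 (negPf c0) => /det0P[v v0]; rewrite mulmxA => vM.
  have [freeM memM _] := basis_rows bM.
  by case/negP: v0; apply/eqP/freeM/(rational_conj_neq0 ratB (memM v) vM).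
have := norm_ge1 intD D0; rewrite normr_prod; congr (_ <= _).
by apply: eq_bigr => i _; rewrite iota_D.
Qed.
End PlueckerNorm.

(** In the product of [prod_det_conj_ge1], each of the [m] factors is at most a
constant times the height. For [i = 0] and [i = 1] the [e] forms involved are
among the [d] forms that vanish on the kernel, since [e < d]: these two factors
gain [psi_angle 1]. *)
Lemma conj_kernel_lower_bound d e : (1 < m)%N -> (0 < e)%N -> (e < d)%N -> (n = d + d)%N ->
  exists C : R, forall B, @rational_subspaces R n e B -> height B != 0 ->
    1 <= C * height B ^+ m * psi_angle 1 (conj_kernel d) B ^+ 2.
Proof.
move=> m1 e0 ed nE.
(* Q bounds all the entries of the matrices conj_powers i e with i < m, and
   1 <= Q as det_mulmx_small_le requires *)
pose Q : R := 1 + \sum_(i < m + e) \sum_(l < n) `|iota (iter i sigma theta) ^+ l|.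
have Q1 : 1 <= Q by rewrite /Q lerDl sumr_ge0 // => i _; rewrite sumr_ge0.
have TQ i : (i < m)%N -> forall l a, `|conj_powers i e l a| <= Q.
  move=> im l a; rewrite mxE /Q.
  have ia : (i + a < m + e)%N by rewrite -addSn leq_add // ltnW.
  rewrite (bigD1 (Ordinal ia)) //= (bigD1 l) //= addrCA -addrA lerDl.
  rewrite addr_ge0 //; first exact: sumr_ge0.
  by rewrite addr_ge0 // !sumr_ge0 // => *; rewrite sumr_ge0.
pose F : R := #|{ffun 'I_e -> 'I_n}|%:R.
pose C1 := F * Q ^+ e.
pose C2 := F * (e%:R * (n.+1%:R * Q) ^+ e * (n%:R ^+ 2 * Q)).
have Q0 : 0 <= Q by apply: le_trans Q1.
have C10 : 0 <= C1 by rewrite mulr_ge0 // exprn_ge0.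
have C20 : 0 <= C2 by rewrite !mulr_ge0 // exprn_ge0 // mulr_ge0.
exists ((C1 + C2) ^+ m) => B ratB hB0.
have dB : \dim B = e by case: ratB.
have [M [c [z [bM c0 zE zh _]]]] := height_pluecker dB hB0.
set h := height B; set w := psi_angle 1 _ B.
have [||X [Y [XA YB X1 Y1 wE]]] := @psi_angle1 R n (conj_kernel d) B.
- by rewrite dim_conj_kernel nE ?leq_addr // addnK (ltn_trans e0).
- by rewrite dB.
have w0 : 0 <= w by rewrite /w wE sqrtr_ge0.
have MH (f : {ffun 'I_e -> 'I_n}) : `|c * \det (colsub f M)| <= h by rewrite -zE.
have n0 : (0 < n)%N by rewrite nE addn_gt0 (ltn_trans e0 ed).
have h0 : 0 <= h := le_trans (normr_ge0 _) (MH [ffun=> Ordinal n0]).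
have big i : (i < m)%N -> `|c * \det (M *m conj_powers i e)| <= (C1 + C2) * h.
  move=> im; apply: le_trans (det_mulmx_le MH (TQ i im)) _.
  by rewrite ler_wpM2r // lerDl.
have small i : (i < 2)%N -> `|c * \det (M *m conj_powers i e)| <= (C1 + C2) * h * w.
  move=> i2; have im : (i < m)%N by apply: leq_trans m1.
  have [_ _ spanM] := basis_rows bM; have [v YE] := spanM Y YB.
  have v0 : v != 0.
    by apply: contraNneq (enorm1_neq0 Y1) => v0; rewrite YE v0 mul0mx.
  rewrite YE in Y1 wE.
  have delta a : `|(v *m M *m conj_powers i e) 0 a| <= n%:R ^+ 2 * Q * w.
    rewrite /w wE; apply: linear_form_le_wedge; [exact: TQ | by [] |].
    move: XA; rewrite mem_conj_kernel => /eqP/rowP.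
    have ia : (i + a < d)%N.
      apply: leq_ltn_trans ed; apply: leq_trans (ltn_ord a).
      by rewrite -add1n leq_add2r -ltnS.
    move=> /(_ (Ordinal ia)); rewrite !mxE => E.
    by rewrite -[RHS]E; apply: eq_bigr => l _; rewrite !mxE.
  apply: le_trans (det_mulmx_small_le MH Q1 (TQ i im) v0 Y1 delta) _.
  have -> : F * (e%:R * (n.+1%:R * Q) ^+ e * (n%:R ^+ 2 * Q * w)) * h = C2 * h * w.
    rewrite /C2; ring.
  by rewrite ler_wpM2r // ler_wpM2r // lerDr.
apply: le_trans (prod_det_conj_ge1 ratB bM c0 zE) _.
move: big small; case: (m) m1 => [|[|m']] // _ big small.
rewrite !big_ord_recl /=.
have splitE (u x y : R) : u ^+ m'.+2 * x ^+ m'.+2 * y ^+ 2 =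
    (u * x * y) * ((u * x * y) * (u * x) ^+ m').
  by rewrite [(u * x) ^+ m']exprMn !(exprS _ m'.+1) !(exprS _ m'); ring.
rewrite splitE.
apply: ler_pM; rewrite ?small //; first by rewrite mulr_ge0 // prodr_ge0.
apply: ler_pM; rewrite ?small //; first by rewrite prodr_ge0.
rewrite -[m' in _ ^+ m'](card_ord m') -prodr_const; apply: ler_prod => i _.
by rewrite normr_ge0 big // /bump /= !add1n !ltnS.
Qed.
End Construction.

(** * The exponent *)

(** The only power of two in the range from [2 d] to [4 d - 1] is divisible by 4,
which improves its upper bound to [4 d - 4]. *)
Lemma exists_pow2_between (d : nat) : (2 <= d)%N ->
  exists k, [/\ (1 < k)%N, (d + d <= 2 ^ k)%N & (2 ^ k <= 4 * (d - 1))%N].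
Proof.
move=> d2; pose k := trunc_log 2 (4 * d - 1).
have lo : (2 ^ k <= 4 * d - 1)%N by apply: trunc_logP => //; lia.
have hi : (4 * d - 1 < 2 ^ k.+1)%N by apply: trunc_log_ltn.
rewrite expnS in hi.
have k1 : (1 < k)%N.
  rewrite ltnNge; apply/negP => k1; have : (2 ^ k <= 2 ^ 1)%N by rewrite leq_exp2l.
  lia.
exists k; split=> //; first lia.
have kE : (2 ^ k = 4 * 2 ^ (k - 2))%N by rewrite -(expnD 2 2) subnKC.
lia.
Qed.

(** If [beta > m / 2], then [psi_angle 1 A B <= height B `^ - beta] and the lower
bound give an upper bound of the height, which leaves finitely many [B]. *)
Lemma mu_le (R : realType) (n m e : nat) (A : {vspace 'rV[R]_n}) (C : R) :
  (0 < \dim A)%N -> (0 < e)%N ->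
  (forall B, @rational_subspaces R n e B -> \dim (A :&: B) = 0%N) ->
  (forall B, @rational_subspaces R n e B -> height B != 0 ->
     1 <= C * height B ^+ m * psi_angle 1 A B ^+ 2) ->
  (mu A e 1 <= (m%:R / 2)%:E)%E.
Proof.
move=> A0 e0 AB lower; apply: ge_ereal_sup => _ [beta [beta0 inf_B] <-].
rewrite lee_fin leNgt; apply/negP => m_beta; apply: inf_B.
pose s : R := beta * 2 - m%:R.
have s0 : 0 < s by rewrite subr_gt0 -ltr_pdivrMr.
apply: sub_finite_set (finite_bounded_height n e (C `^ s^-1)) => B [ratB psiB].
have dB : \dim B = e by case: ratB.
have psi0 : 0 < psi_angle 1 A B by apply: psi_angle1_gt0; rewrite ?dB ?AB.
have h0 : 0 <= height B.
  by rewrite /height; case: xgetP => [_ -> [Xi [_ ->]]|_] //; exact: sqrtr_ge0.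
(* at the default value 0 of the height, the bound on psi would be 0 *)
have hB0 : height B != 0.
  apply: contraTneq psiB => ->; rewrite -ltNge powR0 // oppr_eq0.
  by rewrite gt_eqF.
have hpos : 0 < height B by rewrite lt0r hB0.
split=> //.
have C0 : 0 <= C.
  have := lower B ratB hB0; apply: contraTT; rewrite -!ltNge => C0.
  by rewrite (le_lt_trans _ ltr01) // -mulrA mulr_le0_ge0 ?(ltW C0) // mulr_ge0 // exprn_ge0 // ltW.
have hsC : height B `^ s <= C.
  have le1 : 1 <= C * height B `^ (- s).
    apply: le_trans (lower B ratB hB0) _; rewrite -mulrA ler_wpM2l //.
    have -> : - s = m%:R + - beta * 2%:R by rewrite /s; ring.
    rewrite powRD; last by rewrite hB0 implybT.
    rewrite powR_mulrn // powRrM powR_mulrn ?powR_ge0 // ler_wpM2l ?exprn_ge0 //.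
    by rewrite lerXn2r // nnegrE ?powR_ge0 // ltW.
  by rewrite powRN ler_pdivlMr ?powR_gt0 // mul1r in le1.
have -> : height B = (height B `^ s) `^ s^-1.
  by rewrite -powRrM divff ?gt_eqF // powRr1.
by rewrite ge0_ler_powR ?nnegrE ?powR_ge0 // invr_ge0 ltW.
Qed.

Theorem mainTheorem3 (R : realType) (n d : nat) (hd : (2 <= d)%N)
    (hn : n = (2 * d)%N) :
  (mu_ring R n d (d - 1) 1 <= (2 * d%:R ^+ 2 / (d%:R + 1))%:E)%E.
Proof.
have [k [k1 nm mle]] := exists_pow2_between hd.
have nE : n = (d + d)%N by rewrite hn mul2n addnn.
have [K [j [sigma [iota [theta [indep inj fixed norm int_theta]]]]]] :=
  cyclic_real_field R k1.
rewrite -nE in nm; pose A := conj_kernel sigma iota theta n d.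
have e0 : (0 < d - 1)%N by rewrite subn_gt0.
have ed : (d - 1 < d)%N by lia.
have irrA : @irrational_subspaces R n d (d - 1) 1 A.
  by apply: (conj_kernel_irrational iota nm indep inj fixed); lia.
have m1 : (1 < 2 ^ k)%N by apply: leq_trans nm; lia.
have [C lower] := conj_kernel_lower_bound nm indep inj fixed norm int_theta m1 e0 ed nE.
have muA : (mu A (d - 1) 1 <= ((2 ^ k)%:R / 2)%:E)%E.
  apply: mu_le lower => //; first by case: irrA => ->; lia.
  by move=> B ratB; case: irrA => _ /(_ B ratB); rewrite ltnS leqn0 => /eqP.
apply: le_trans (le_trans _ muA) _; first by apply: ereal_inf_lbound; exists A.
rewrite lee_fin ler_pdivlMr ?ltr_wpDl // mulrAC ler_pdivrMr //.
have : (2 ^ k)%:R <= 4 * (d%:R - 1) :> R.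
  by have := mle; rewrite -(ler_nat R) natrM natrB // ltnW.
have d1 : 1 <= d%:R :> R by rewrite ler1n ltnW.
move: ((2 ^ k)%:R) (d%:R) d1 => x y y1 xy.
have : x * (y + 1) <= 4 * (y - 1) * (y + 1) by rewrite ler_wpM2r //; lra.
nra.
Qed.
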